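(* Let $h\ge 2$ be an integer and $\underline{\ell}=(\ell_1,\ldots,\ell_h)\in\mathbb{Z}_{>0}^h$. The initial ideal $\mathrm{in}_\prec(I_{B_{\underline{\ell},h}})$ has regular quotients with respect to the order $m_1,m_2,\ldots,m_{\frac{h(h-1)}{2}}$ of its minimal generators. More precisely, the colon ideal $(m_1,\ldots,m_{k-1}):m_k$ is generated by a regular sequence of length $r_k$ for $k=2,\ldots,\frac{h(h-1)}{2}$, where $$(r_2,\ldots,r_{\frac{h(h-1)}{2}})=(\underbrace{1,1}_{2},\underbrace{2,2,2}_{3},\ldots,\underbrace{h-2,h-2,\ldots,h-2}_{h-1}).$$
   Context: $\mathbb{K}$ is a field. The graph $B_{\underline{\ell},h}$ consists of $h$ paths of lengths $2\ell_1,\ldots,2\ell_h$ from a common vertex $y_1$ to another common vertex $y_2$, the paths being otherwise disjoint: its vertices are $y_1,y_2$ and $x_{i,j}$ for $1\le j\le h$, $1\le i\le 2\ell_j-1$, and its edges are $e_{1,j}=\{y_1,x_{1,j}\}$, $e_{i,j}=\{x_{i-1,j},x_{i,j}\}$ for $2\le i\le 2\ell_j-1$, and $e_{2\ell_j,j}=\{x_{2\ell_j-1,j},y_2\}$, for $1\le j\le h$. For a simple graph $G$ with edge set $E$, the toric ideal $I_G$ is the kernel of the $\mathbb{K}$-algebra map from the polynomial ring $\mathbb{K}[E]$ (variables indexed by edges) to the polynomial ring on the vertices, sending an edge $\{a,b\}$ to $ab$. Here $R=\mathbb{K}[e_{i,j}: 1\le j\le h,\ 1\le i\le 2\ell_j]$.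 $\prec$ is the pure lexicographic monomial order on $R$ induced by the following order of variables: $e_{i_1,j_1}\succ e_{i_2,j_2}$ if and only if either $i_1$ is odd and $i_2$ is even, or $i_1\equiv i_2 \pmod 2$ and $i_1<i_2$, or $i_1=i_2$ and $j_1<j_2$. For $1\le i<j\le h$ put $u_{i,j}=e_{1,i}e_{3,i}\cdots e_{2\ell_i-1,i}\,e_{2,j}e_{4,j}\cdots e_{2\ell_j,j}$; these monomials are the minimal generators of $\mathrm{in}_\prec(I_{B_{\underline{\ell},h}})$. They are listed in $\prec$-increasing order as $m_1,\ldots,m_{h(h-1)/2}$, i.e. $u_{h-1,h},\ u_{h-2,h},\ u_{h-2,h-1},\ \ldots,\ u_{i,h},u_{i,h-1},\ldots,u_{i,i+1},\ \ldots,\ u_{1,h},\ldots,u_{1,2}$; so $m_1=u_{h-1,h}$, $m_2=u_{h-2,h}$, and $m_{h(h-1)/2}=u_{1,2}$. A monomial ideal has regular quotients with respect to an order $f_1,\ldots,f_m$ of its minimal generators if $(f_1,\ldots,f_{i-1}):f_i$ is generated by a regular sequence on $R$ for all $i=2,\ldots,m$. *)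

(* Defs.v *)
From HB Require Import structures.
From mathcomp Require Import all_boot all_order all_algebra.
From mathcomp Require Import zify.
From mathcomp Require Export mpoly.

Set Implicit Arguments.
Unset Strict Implicit.
Unset Printing Implicit Defensive.

Import GRing.Theory.

Section Ideals.
Variable R : comNzRingType.
Local Open Scope ring_scope.
Implicit Types (I J S : R -> Prop) (s : seq R) (f : R).

Definition same_ideal I J := forall p, I p <-> J p.

Definition ideal_gen S : R -> Prop := fun p =>
  exists2 s : seq (R * R), (forall c, c \in s -> S c.2)
                         & p = \sum_(c <- s) c.1 * c.2.

Definition seq_ideal s : R -> Prop := ideal_gen (fun f => f \in s).

Definition colon I f : R -> Prop := fun p => I (p * f).

Definition regular_sequence s : Prop :=
  (forall i : nat, (i < size s)%N -> forall p : R,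
     seq_ideal (take i s) (p * s`_i) -> seq_ideal (take i s) p)
  /\ ~ seq_ideal s 1.

End Ideals.

Section InitialIdeals.
Variables (K : fieldType) (n : nat).
Implicit Types (I : {mpoly K[n]} -> Prop) (ms : seq 'X_{1..n}).
Local Open Scope ring_scope.

Definition is_lead_monomial (lt : rel 'X_{1..n}) (f : {mpoly K[n]}) m : Prop :=
  m \in msupp f /\ forall m', m' \in msupp f -> m' != m -> lt m' m.

Definition initial_ideal (lt : rel 'X_{1..n}) I : {mpoly K[n]} -> Prop :=
  ideal_gen (fun g => exists f m,
    [/\ I f, is_lead_monomial lt f m & g = 'X_[m]]).

Definition mono_ideal ms : {mpoly K[n]} -> Prop :=
  seq_ideal [seq 'X_[m] | m <- ms].

(* The second condition also excludes repetitions in [ms], since [rem] deletes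
   a single occurrence. *)
Definition minimal_generators I ms : Prop :=
  same_ideal I (mono_ideal ms)
  /\ forall m, m \in ms -> ~ mono_ideal (rem m ms) 'X_[m].

(* [nth 0 ms k.-1] is the k-th generator and [take k.-1 ms] lists those before
   it, for k counted from 1. *)
Definition colon_before ms (k : nat) : {mpoly K[n]} -> Prop :=
  colon (mono_ideal (take k.-1 ms)) 'X_[nth 0%MM ms k.-1].

Definition regular_quotients I ms : Prop :=
  minimal_generators I ms
  /\ forall k : nat, (2 <= k <= size ms)%N ->
     exists2 s, regular_sequence s
              & same_ideal (colon_before ms k) (seq_ideal s).

End InitialIdeals.

(* Polynomials in variables indexed by a finite type E are elements of
   {mpoly K[#|E|]}, the variable of e : E being 'X_(enum_rank e). *)
Section VariableOrder.
Variables (E : finType) (gt : rel E).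

(* The exponents of m and m' agree on all variables above e, and m has the
   smaller exponent on e. *)
Definition lex_lt : rel 'X_{1..#|E|} := fun m m' =>
  [exists e, (m (enum_rank e) < m' (enum_rank e))
    && [forall e', gt e' e ==> (m (enum_rank e') == m' (enum_rank e'))]].

End VariableOrder.

Record sgraph := SGraph {
  vert : finType;
  edge : finType;
  ends : edge -> {set vert};
  ends_card : forall e, #|ends e| = 2;
  ends_inj : injective ends }.

Section ToricIdeal.
Variables (K : fieldType) (G : sgraph).
Local Open Scope ring_scope.

Definition edge_image (i : 'I_#|edge G|) : {mpoly K[#|vert G|]} :=
  \prod_(v in ends (enum_val i)) 'X_(enum_rank v).

Definition toric_map (f : {mpoly K[#|edge G|]}) : {mpoly K[#|vert G|]} :=
  f \mPo [tuple edge_image i | i < #|edge G|].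

Definition toric_ideal : {mpoly K[#|edge G|]} -> Prop :=
  fun f => toric_map f = 0.

End ToricIdeal.

Section BGraph.
Variables (h : nat) (l : 'I_h -> nat).

(* [inl false] is y_1, [inl true] is y_2, and [inr (Tagged _ p)], with
   p : 'I_(2 * l j).-1, is x_{p+1,j}. *)
Definition bvert : finType := (bool + {j : 'I_h & 'I_(2 * l j).-1})%type.

(* [Tagged _ i], with i : 'I_(2 * l j), is e_{i+1,j}. *)
Definition bedge : finType := {j : 'I_h & 'I_(2 * l j)}.

Definition path_of (e : bedge) : 'I_h := tag e.
Definition pos_of (e : bedge) : nat := (tagged e).+1.

(* The vertex at distance p <= 2 * l j from y_1 on the j-th path. *)
Definition path_vertex (j : 'I_h) (p : nat) : bvert :=
  if p == 0 then inl false
  else if insub p.-1 is Some i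
    then inr (Tagged (fun j => 'I_(2 * l j).-1) (i : 'I_(2 * l j).-1))
  else inl true.

Definition bends (e : bedge) : {set bvert} :=
  [set path_vertex (path_of e) (pos_of e).-1; path_vertex (path_of e) (pos_of e)].

Lemma path_vertex_eq j j' p p' : p <= 2 * l j -> p' <= 2 * l j' ->
  path_vertex j p = path_vertex j' p' ->
  [\/ p = 0 /\ p' = 0, p = 2 * l j /\ p' = 2 * l j' | j = j' /\ p = p'].
Proof.
rewrite /path_vertex => pl pl'.
case: (eqVneq p 0) => p0; case: (eqVneq p' 0) => p0'.
- by move=> _; apply: Or31.
- by case: insubP.
- by case: insubP.
case: insubP => [i _ iE|pE]; case: insubP => [i' _ iE'|pE'] //.
  case=> jj'; move: (i') iE'; rewrite -jj' => i2 iE' /eqP.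
  rewrite eq_Tagged /= => /eqP ii; apply: Or33; split=> //.
  rewrite ii in iE; have := etrans (esym iE) iE'; lia.
move: pE pE'; rewrite -!leqNgt => pE pE' _; apply: Or32; lia.
Qed.

Lemma bends_card e : #|bends e| = 2.
Proof.
rewrite cards2; case: eqP => //; case: e => j i /=.
have ilt := ltn_ord i; rewrite /path_of /pos_of /= => /path_vertex_eq.
by move=> /(_ (ltnW ilt) ilt) [[]|[]|[]]; lia.
Qed.

Lemma bends_inj : injective bends.
Proof.
move=> [j i] [j' i'] /setP E; have il := ltn_ord i; have il' := ltn_ord i'.
have [jj ii]: j = j' /\ i = i' :> nat.
  move: (E (path_vertex j i)) (E (path_vertex j i.+1)).
  rewrite /bends /path_of /pos_of /= !inE !eqxx !orbT /= => /esym E1 /esym E2.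
  have K p p' (H : path_vertex j p == path_vertex j' p')
    (Hp : p <= 2 * l j) (Hp' : p' <= 2 * l j') :=
    path_vertex_eq Hp Hp' (eqP H).
  case/orP: E1 => [/K/(_ (ltnW il) (ltnW il'))|/K/(_ (ltnW il) il')] P1;
  case/orP: E2 => [/K/(_ il (ltnW il'))|/K/(_ il il')] P2;
  case: P1 => -[? ?]; case: P2 => -[? ?];
  by [exfalso; lia | split=> //; lia].
move: il il'; case: _ / jj i' ii E => i' ii _ _ _.
by congr Tagged; apply: val_inj.
Qed.

Definition bgraph : sgraph := SGraph bends_card bends_inj.

Definition edge_gt : rel bedge := fun e1 e2 =>
  [|| odd (pos_of e1) && ~~ odd (pos_of e2),
      (odd (pos_of e1) == odd (pos_of e2)) && (pos_of e1 < pos_of e2)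
    | (pos_of e1 == pos_of e2) && (path_of e1 < path_of e2)].

Definition umon (i j : 'I_h) : 'X_{1..#|bedge|} :=
  (\sum_(e : bedge | (path_of e == i) && odd (pos_of e)) U_(enum_rank e)
   + \sum_(e : bedge | (path_of e == j) && ~~ odd (pos_of e)) U_(enum_rank e))%MM.

Definition umons : seq 'X_{1..#|bedge|} :=
  [seq umon i j | i <- rev (enum 'I_h),
                  j <- rev [seq j : 'I_h <- enum 'I_h | i < j]].

Lemma umonE i j e : umon i j (enum_rank e) =
  ((path_of e == i) && odd (pos_of e)) + ((path_of e == j) && ~~ odd (pos_of e)).
Proof.
have S (P : pred bedge) :
    \sum_(e' | P e') (U_(enum_rank e'))%MM (enum_rank e) = P e :> nat.
  rewrite (eq_bigr (fun e' => e' == e : nat)) => [|e' _]; last first.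
    by rewrite mnm1E (inj_eq enum_rank_inj).
  rewrite big_mkcond (bigD1 e) //= eqxx big1 ?addn0 => [|e' /negPf->].
    by case: (P e).
  by case: (P e').
by rewrite /umon mnmDE !mnm_sumE !S.
Qed.

Lemma size_umons : size umons = (h * h.-1)./2.
Proof.
rewrite size_allpairs_dep map_rev sumn_rev sumnE big_map big_enum /=.
rewrite (eq_bigr (fun i : 'I_h => h.-1 - i)) => [|i _]; last first.
  rewrite size_rev size_filter -(count_map (@nat_of_ord h) (fun j => i < j)).
  rewrite val_enum_ord; move: (nat_of_ord i) (ltn_ord i) => k kh.
  rewrite -[in iota _ _](subnKC kh) iotaD count_cat.
  rewrite (eq_in_count (a2 := pred0)) ?count_pred0 => [|j]; last first.
    by rewrite mem_iota /=; lia.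
  rewrite (eq_in_count (a2 := predT)) ?count_predT ?size_iota => [|j]; last first.
    by rewrite mem_iota /=; lia.
  by lia.
rewrite -(big_mkord xpredT (fun i => h.-1 - i)) big_nat_rev /=.
rewrite (eq_big_nat _ _ (F2 := fun i => i)) => [|i]; last by lia.
by rewrite bin2_sum bin2.
Qed.

Lemma umons_increasing : (forall j, 0 < l j) ->
  pairwise (lex_lt edge_gt) umons.
Proof.
move=> l0.
have Q (P : pred 'I_h) :
    pairwise (fun a b : 'I_h => b < a) (rev [seq j <- enum 'I_h | P j]).
  rewrite -sorted_pairwise => [|b a c ba cb]; last exact: ltn_trans cb ba.
  rewrite rev_sorted sorted_pairwise => [|b a c]; last exact: ltn_trans.
  apply: pairwise_filter; rewrite -(pairwise_map (@nat_of_ord h) ltn).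
  by rewrite val_enum_ord -(sorted_pairwise ltn_trans) iota_ltn_sorted.
have P (s : seq 'I_h) : pairwise (fun a b : 'I_h => b < a) s ->
  pairwise (lex_lt edge_gt)
    [seq umon i j | i <- s, j <- rev [seq j : 'I_h <- enum 'I_h | i < j]].
  elim: s => //= a s IH /andP[/allP as_ /IH {}IH].
  rewrite pairwise_cat {}IH andbT; apply/andP; split.
    apply/allrelP => _ _ /mapP[j _ ->] /allpairsPdep[i [k [/as_ ia _ ->]]].
    have i0 : 0 < 2 * l i by have := l0 i; lia.
    pose e := Tagged (fun j => 'I_(2 * l j)) (Ordinal i0) : bedge.
    apply/existsP; exists e; rewrite !umonE /path_of /pos_of /= eqxx.
    have -> : (i == a) = false by apply/eqP => iE; rewrite iE ltnn in ia.
    rewrite andbF /=; apply/forallP => -[j' p]; apply/implyP.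
    rewrite /edge_gt !umonE /path_of /pos_of /= => /or3P[||/andP[/eqP p0 ji]].
    - by rewrite andbF.
    - by rewrite ltnS ltn0 andbF.
    have -> : (j' == a) = false by apply/eqP => E; subst; lia.
    have -> : (j' == i) = false by apply/eqP => E; subst; lia.
    by rewrite (succn_inj p0) !andbF.
  rewrite pairwise_map.
  move: (Q (fun j => a < j)); apply: sub_pairwise => j j' jj' /=.
  have j0 : 1 < 2 * l j' by have := l0 j'; lia.
  pose e := Tagged (fun j => 'I_(2 * l j)) (Ordinal j0) : bedge.
  apply/existsP; exists e; rewrite !umonE /path_of /pos_of /= eqxx !andbF.
  have -> : (j' == j) = false by apply/eqP => iE; rewrite iE ltnn in jj'.
  apply/forallP => -[k p]; apply/implyP.
  rewrite /edge_gt !umonE /path_of /pos_of /= => /or3P[||/andP[/eqP p1 ki]].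
  - by rewrite andbT => ->; rewrite !andbF.
  - by case: (nat_of_ord p) => [|?] //; rewrite ltnS andbC.
  have -> : (k == j) = false by apply/eqP => E; subst; lia.
  by have -> : (k == j') = false by apply/eqP => E; subst; lia.
by apply: P; move: (Q predT); rewrite filter_predT.
Qed.

End BGraph.

(* (r_2, ..., r_{h(h-1)/2}): each d in 1, ..., h-2 is repeated d+1 times. *)
Definition colon_lengths (h : nat) : seq nat :=
  flatten [seq nseq d.+1 d | d <- iota 1 (h - 2)].

Lemma size_colon_lengths h : 2 <= h ->
  size (colon_lengths h) = ((h * h.-1)./2).-1.
Proof.
case: h => [|[|h]] // _; rewrite /colon_lengths !subSS subn0.
elim: h => // h IH.
rewrite -[in iota _ _](addn1 h) iotaD map_cat flatten_cat size_cat IH.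
by rewrite /= cats0 size_nseq; lia.
Qed.

(* Main.v *)
Require Import Defs.
From HB Require Import structures.
From mathcomp Require Import all_boot all_order all_algebra.
From mathcomp Require Import zify.

Set Implicit Arguments.
Unset Strict Implicit.
Unset Printing Implicit Defensive.

Import GRing.Theory.

(** Write [O_i] and [E_i] for the products of the edges of odd and of even
    position on the path [i], so that [u_{i,j} = O_i E_j].

    For the initial ideal, two facts are needed. On the one hand [O_i] covers
    every vertex of the path but [y_2], and [E_i] every vertex but [y_1]
    ([vdeg_half_path]); hence [O_i E_j] and [O_j E_i] have the same image in
    the vertex ring, their difference lies in the toric ideal, and for [i < j]
    its lead monomial is [u_{i,j}] ([umon_is_lead]). On the other hand the lead
    monomial [m] of an element of the toric ideal shares its image with some
    smaller monomial [m'], since the terms in each fibre cancel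
    ([toric_ideal_fibre]). The difference of the exponents of [m] and [m']
    alternates along each path and sums to 0 around [y_1], which forces some
    [u_{i,j}] to divide [m] ([umon_divides_larger]). The [u_{i,j}] do not
    divide each other, so they generate minimally.

    The rest concerns monomial ideals. The generators listed before [u_{a,b}]
    are the [u_{i,j}] with [i > a], or [i = a] and [j > b]. Dividing them by
    their common factors with [u_{a,b}] leaves, up to multiples, one half of
    each path [c > a] other than [b]: [O_c] if [c < b] and [E_c] if [c > b]
    ([colon_divisibility]). These monomials lie on disjoint paths, so they are
    pairwise coprime and form a regular sequence
    ([regular_sequence_coprime]). Counting paths from 0, their number is
    [h - 2 - a], and [a] is the first index of [h - 1 - a] generators: this is
    the sequence of lengths ([colon_lengths_path_pairs]). *)

(** * Monomial ideals *)

Section MonomialIdeals.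
Variables (K : fieldType) (n : nat).
Implicit Types (m u : 'X_{1..n}) (ms : seq 'X_{1..n}) (p : {mpoly K[n]}).
Local Open Scope ring_scope.

Definition divided_by_some ms m := has (fun g => (g <= m)%MM) ms.

Lemma divided_by_some_le ms m m' :
  (m <= m')%MM -> divided_by_some ms m -> divided_by_some ms m'.
Proof.
by move=> mm' /hasP[g gms gm]; apply/hasP; exists g; rewrite // (lepm_trans gm).
Qed.

(** A monomial ideal consists of the polynomials all of whose monomials are
    divisible by a generator. Every later ideal computation is thereby reduced
    to divisibility between exponent vectors. *)
Lemma mono_idealP ms p :
  mono_ideal ms p <-> {in msupp p, forall m, divided_by_some ms m}.
Proof.
split=> [[s sms ->] m /msupp_sum_le/flatten_mapP[c]|pms].
  rewrite filter_predT => cs; have /mapP[g gms ->] := sms _ cs.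
  rewrite (perm_mem (msuppMX _ _)) => /mapP[m' _ ->].
  by apply/hasP; exists g; rewrite // lem_addr.
pose f m := nth 0%MM ms (find (fun g => (g <= m)%MM) ms).
exists [seq (p@_m *: 'X_[(m - f m)%MM], 'X_[f m]) | m <- msupp p].
  by move=> _ /mapP[m mp ->] /=; rewrite map_f // mem_nth // -has_find; apply: pms.
rewrite big_map [LHS]mpolyE; apply: eq_big_seq => m mp /=.
by rewrite -scalerAl -mpolyXD submK // (nth_find 0%MM (pms _ mp)).
Qed.

Lemma mono_idealX ms m :
  mono_ideal ms ('X_[m] : {mpoly K[n]}) <-> divided_by_some ms m.
Proof.
rewrite mono_idealP msuppX; split=> [|m_ms m']; first by apply; rewrite inE.
by rewrite inE => /eqP->.
Qed.

Lemma colon_mono_idealP ms u p :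
  colon (mono_ideal ms) 'X_[u] p
    <-> {in msupp p, forall m, divided_by_some ms (u + m)%MM}.
Proof.
rewrite /colon mono_idealP; split=> H m.
  by move=> mp; apply: H; rewrite (perm_mem (msuppMX _ _)) map_f.
by rewrite (perm_mem (msuppMX _ _)) => /mapP[m' /H + ->].
Qed.

Definition coprime_monomials : rel 'X_{1..n} :=
  fun m m' => [forall i, (m i == 0%N) || (m' i == 0%N)].

(** If [g] divides [u * m] and is coprime to [u] then [g] divides [m]; so
    multiplication by a monomial coprime to the earlier ones is injective
    modulo them. *)
Lemma regular_sequence_coprime ms :
  pairwise coprime_monomials ms -> 0%MM \notin ms ->
  regular_sequence [seq ('X_[m] : {mpoly K[n]}) | m <- ms].
Proof.
move=> cop ms0; split=> [i|].
  rewrite size_map => ims p; rewrite -map_take (nth_map 0%MM) //.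
  move=> /colon_mono_idealP pms; apply/mono_idealP => m /pms/hasP[g gms gm].
  apply/hasP; exists g => //; apply/mnm_lepP => k.
  have: coprime_monomials g (nth 0%MM ms i).
    move: cop; rewrite -(cat_take_drop i ms) pairwise_cat => /andP[/allrelP cop _].
    rewrite cat_take_drop; apply: cop => //.
    by rewrite (drop_nth 0%MM) // mem_head.
  move=> /forallP/(_ k); move/mnm_lepP/(_ k): gm; rewrite mnmDE.
  by case: (g k) => //= gk + /eqP E; rewrite E.
rewrite -mpolyX0 => /mono_idealX/hasP[g gms g0].
move/negP: ms0; apply; suff -> : 0%MM = g by [].
by apply/mnmP => k; move/mnm_lepP/(_ k): g0; rewrite mnm0E leqn0 => /eqP.
Qed.

(** The criterion by which an initial ideal is computed here: it replaces the
    verification that a given set of elements is a Groebner basis. *)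
Lemma initial_ideal_mono (lt : rel 'X_{1..n}) (I : {mpoly K[n]} -> Prop) ms :
  (forall m, m \in ms -> exists2 f, I f & is_lead_monomial lt f m) ->
  (forall f m, I f -> is_lead_monomial lt f m -> divided_by_some ms m) ->
  same_ideal (initial_ideal lt I) (mono_ideal ms).
Proof.
move=> ms_lead lead_ms p; split=> [[s sI ->]|[s sms ->]]; last first.
  exists s => // c /sms/mapP[m /ms_lead[f If fm] ->].
  by exists f, m.
apply/mono_idealP => m /msupp_sum_le/flatten_mapP[c].
rewrite filter_predT => cs; have [f [g [If fg ->]]] := sI _ cs.
rewrite (perm_mem (msuppMX _ _)) => /mapP[m' _ ->].
by apply: divided_by_some_le (lead_ms _ _ If fg); rewrite lem_addr.
Qed.

Lemma minimal_generators_mono (I : {mpoly K[n]} -> Prop) ms :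
  same_ideal I (mono_ideal ms) -> uniq ms ->
  {in ms &, forall g m, (g <= m)%MM -> g = m} ->
  minimal_generators I ms.
Proof.
move=> Ims ums anti; split=> // m mms /mono_idealX/hasP[g].
rewrite mem_rem_uniq // => /andP[/= /eqP gm gms] g_le_m.
by apply: gm; apply: anti.
Qed.

End MonomialIdeals.

(** * Toric ideals of graphs *)

Section ToricIdeals.
Variables (K : fieldType) (G : sgraph).
Implicit Types (m : 'X_{1..#|edge G|}) (v : vert G).
Local Open Scope ring_scope.

Definition vdeg m v := (\sum_(e | v \in ends e) m (enum_rank e))%N.

Lemma vdegD m m' v : vdeg (m + m')%MM v = (vdeg m v + vdeg m' v)%N.
Proof. by rewrite -big_split; apply: eq_bigr => e _; rewrite mnmDE. Qed.

Definition vertex_monomial m : 'X_{1..#|vert G|} :=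
  [multinom vdeg m (enum_val i) | i < #|vert G|].

Lemma toric_mapX m :
  toric_map ('X_[m] : {mpoly K[#|edge G|]}) = 'X_[vertex_monomial m].
Proof.
rewrite /toric_map comp_mpolyX.
transitivity (\prod_(i < #|edge G|)
   'X_[(\sum_(v in ends (enum_val i)) U_(enum_rank v)) *+ m i] : {mpoly K[#|vert G|]}).
  by apply: eq_bigr => i _; rewrite tnth_mktuple /edge_image mprodXE mpolyXn.
rewrite mprodXE; congr 'X_[_]; apply/mnmP => i.
rewrite mnmE mnm_sumE /vdeg (reindex _ (onW_bij _ (@enum_val_bij (edge G)))) /=.
rewrite [RHS]big_mkcond; apply: eq_bigr => e _.
rewrite mulmnE mnm_sumE enum_valK; case: ifP => ie.
  rewrite (bigD1 (enum_val i)) //= big1 ?mnm1E ?enum_valK ?eqxx ?addn0 ?mul1n //.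
  move=> v /andP[_ vi].
  by rewrite mnm1E -(inj_eq enum_val_inj) enum_rankK (negPf vi).
rewrite big1 // => v ve; rewrite mnm1E -(inj_eq enum_val_inj) enum_rankK.
by case: eqP => // vi; rewrite -vi ve in ie.
Qed.

Lemma toric_binomial m m' : vdeg m =1 vdeg m' ->
  toric_ideal ('X_[m] - 'X_[m'] : {mpoly K[#|edge G|]}).
Proof.
move=> mm'; rewrite /toric_ideal /toric_map raddfB /= -!/(toric_map _) !toric_mapX.
by apply/eqP; rewrite subr_eq0; apply/eqP; congr 'X_[_]; apply/mnmP => i; rewrite !mnmE.
Qed.

(** The toric map sends monomials to monomials, so the terms of an element of
    its kernel cancel within each fibre: no monomial is alone in its fibre. *)
Lemma toric_ideal_fibre (f : {mpoly K[#|edge G|]}) m :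
  toric_ideal f -> m \in msupp f ->
  exists m', [/\ m' \in msupp f, m' != m & vdeg m' =1 vdeg m].
Proof.
move=> f0 mf.
pose fibre m' := (m' != m) && (vertex_monomial m' == vertex_monomial m).
case: (altP (@hasP _ fibre (msupp f))).
  case=> m' m'f /andP[m'm /eqP/mnmP E]; exists m'; split=> // v.
  by have := E (enum_rank v); rewrite !mnmE enum_rankK.
move=> /hasPn alone; move: (mf); rewrite mcoeff_msupp => /eqP[].
transitivity ((toric_map f)@_(vertex_monomial m)); last by rewrite f0 mcoeff0.
rewrite /toric_map comp_mpolyEX raddf_sum /= (bigD1_seq m) //=.
rewrite big_seq_cond big1 ?addr0 => [|m' /andP[/alone m'f m'm]].
  by rewrite -/(toric_map _) toric_mapX mcoeffZ mcoeffX eqxx mulr1.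
rewrite -/(toric_map _) toric_mapX mcoeffZ mcoeffX.
by move: m'f; rewrite /fibre m'm /= => /negPf->; rewrite mulr0.
Qed.

End ToricIdeals.

(** * The half paths of B *)

Section HalfPaths.
Variables (h : nat) (l : 'I_h -> nat).
Implicit Types (i j a b c : 'I_h) (m : 'X_{1..#|bedge l|}) (v : bvert l).

Definition half_path i (o : bool) : 'X_{1..#|bedge l|} :=
  [multinom
    ((path_of (enum_val k) == i) && (odd (pos_of (enum_val k)) == o) : nat)
    | k < #|bedge l|].

Lemma half_pathE i o e :
  half_path i o (enum_rank e) = (path_of e == i) && (odd (pos_of e) == o) :> nat.
Proof. by rewrite mnmE enum_rankK. Qed.

Lemma mnm_eq_edges m m' : (forall e, m (enum_rank e) = m' (enum_rank e)) -> m = m'.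
Proof. by move=> E; apply/mnmP => k; rewrite -[k]enum_valK E. Qed.

Lemma mnm_le_edges m m' :
  reflect (forall e, m (enum_rank e) <= m' (enum_rank e)) (m <= m')%MM.
Proof.
apply: (iffP mnm_lepP) => E k; first exact: E.
by rewrite -[k]enum_valK E.
Qed.

Lemma umon_half_path i j : umon l i j = (half_path i true + half_path j false)%MM.
Proof.
by apply: mnm_eq_edges => e; rewrite umonE mnmDE !half_pathE eqb_id eqbF_neg.
Qed.

Definition bedge_at i p (pl : p < 2 * l i) : bedge l :=
  Tagged (fun j => 'I_(2 * l j)) (Ordinal pl).

Lemma alternating_telescope (g : nat -> nat) n :
  \sum_(q < 2 * n | odd q == false) (g q + g q.+1) + g (2 * n)
    = \sum_(q < 2 * n | odd q == true) (g q + g q.+1) + g 0.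
Proof.
rewrite mul2n big_mkcond [in RHS]big_mkcond /=.
elim: n => [|n IH]; first by rewrite !big_ord0.
by rewrite doubleS !big_ord_recr /= odd_double /=; lia.
Qed.

Lemma path_vertex_end i : 0 < l i -> path_vertex l i (2 * l i) = inl true.
Proof.
move=> l0; rewrite /path_vertex muln_eq0 /= (gtn_eqF l0) insubN //.
by rewrite -[l i]prednK // mulnS ltnn.
Qed.

(** The odd edges of a path match all its vertices but [y_2], the even edges
    all but [y_1]. *)
Lemma vdeg_half_path i v : 0 < l i ->
  @vdeg (bgraph l) (half_path i true) v + (v == inl true)
    = @vdeg (bgraph l) (half_path i false) v + (v == inl false).
Proof.
move=> l0; have E o : @vdeg (bgraph l) (half_path i o) v =
    \sum_(q < 2 * l i | odd q == ~~ o)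
      ((v == path_vertex l i q) + (v == path_vertex l i q.+1)).
  rewrite /vdeg.
  transitivity (\sum_(e : bedge l | (path_of e == i) && (odd (pos_of e) == o))
                   (v \in bends e : nat)).
    rewrite big_mkcond [RHS]big_mkcond; apply: eq_bigr => e _ /=.
    by rewrite half_pathE; do 2 case: ifP.
  rewrite -(sig_big_dep (fun j => j == i) (fun j (q : 'I_(2 * l j)) => odd q.+1 == o)
     (fun j q => (v \in bends (Tagged (fun j => 'I_(2 * l j)) q)) : nat)) /=.
  rewrite big_pred1_eq; apply: eq_big => [q|q _]; first by case: (odd q) o => [] [].
  (* an edge has two distinct ends, so membership is a sum of two tests *)
  have := bends_card (Tagged (fun j => 'I_(2 * l j)) q);
  rewrite /bends cards2 /path_of /pos_of /= !inE.
  by case: (eqVneq v (path_vertex l i q)) => [->|_] //=; case: eqVneq.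
have := alternating_telescope (fun p => (v == path_vertex l i p) : nat) (l i).
by rewrite !E path_vertex_end.
Qed.

Lemma bedge_eq (e e' : bedge l) :
  path_of e = path_of e' -> pos_of e = pos_of e' -> e = e'.
Proof.
case: e e' => [i p] [j q]; rewrite /path_of /pos_of /= => ij [pq].
by case: _ / ij q pq => q pq; congr Tagged; apply: val_inj.
Qed.

Lemma vdeg_interior m i p (pl : p.+1 < 2 * l i) :
  @vdeg (bgraph l) m (path_vertex l i p.+1)
    = m (enum_rank (bedge_at (ltnW pl))) + m (enum_rank (bedge_at pl)).
Proof.
rewrite /vdeg (bigD1 (bedge_at (ltnW pl))) /=; last by rewrite !inE eqxx orbT.
congr (_ + _); rewrite (big_pred1 (bedge_at pl)) // => -[j q] /=.
apply/idP/eqP => [|->]; last first.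
  rewrite !inE eqxx /=; apply/eqP => /(congr1 (@pos_of h l)) []; lia.
rewrite !inE /path_of /pos_of /= => /andP[+ /eqP ne].
have ql := ltn_ord q.
case/orP => /eqP/path_vertex_eq.
  move=> /(_ (ltnW pl) (ltnW ql)) [[]|[]|[ij pq]]; [lia|lia|].
  by apply: bedge_eq; rewrite /path_of /pos_of /= ?pq.
move=> /(_ (ltnW pl) ql) [[]|[]|[ij pq]]; [lia|lia|].
by case: ne; apply: bedge_eq; rewrite /path_of /pos_of /= ?pq.
Qed.

Hypothesis l_gt0 : forall i, 0 < l i.

Lemma bit_lt i (o : bool) : o < 2 * l i.
Proof. by have := l_gt0 i; case: o; lia. Qed.

(** The first two edges of a path witness the two parities; the boolean index
    [o], read as a number, treats both at once. *)
Definition front_edge i (o : bool) : bedge l := bedge_at (bit_lt i o).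

Lemma vdeg_y1 m :
  @vdeg (bgraph l) m (inl false) = \sum_i m (enum_rank (front_edge i false)).
Proof.
rewrite /vdeg.
transitivity (\sum_(e : bedge l | true && (nat_of_ord (tagged e) == 0))
    m (enum_rank (Tagged (fun j => 'I_(2 * l j)) (tagged e) : bedge l))).
  apply: eq_big => -[j q] //=; rewrite !inE /path_of /pos_of /=.
  have y1 : inl false = path_vertex l j 0 by [].
  rewrite y1; have ql := ltn_ord q.
  apply/orP/eqP => [[]/eqP/path_vertex_eq|->]; last by left.
    by case/(_ isT (ltnW ql)) => -[]; lia.
  by case/(_ isT ql) => -[]; lia.
rewrite -(sig_big_dep predT (fun j (q : 'I_(2 * l j)) => nat_of_ord q == 0)
  (fun j q => m (enum_rank (Tagged (fun j => 'I_(2 * l j)) q : bedge l)))) /=.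
by apply: eq_bigr => i _; apply: big_pred1 => q.
Qed.

(** At an interior vertex the exponents of the two edges have a fixed sum, so
    the difference of two exponent vectors with the same vertex degrees
    alternates in sign along each path. *)
Lemma vdeg_eq_alternating m m' e :
    @vdeg (bgraph l) m =1 @vdeg (bgraph l) m' ->
  let x := m (enum_rank e) in let x' := m' (enum_rank e) in
  let y := m (enum_rank (front_edge (path_of e) false)) in
  let y' := m' (enum_rank (front_edge (path_of e) false)) in
  if odd (pos_of e) then x + y' = x' + y else x + y = x' + y'.
Proof.
move=> E; have [i [p [pl ->]]] : exists i p (pl : p < 2 * l i), e = bedge_at pl.
  by case: e => i [p pl]; exists i, p, pl.
rewrite [path_of _]/= [pos_of _]/=.
elim: p pl => [|p IH] pl.
  have -> : bedge_at pl = front_edge i false by apply: bedge_eq.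
  exact: addnC.
have := E (path_vertex l i p.+1); rewrite !(vdeg_interior _ pl) /=.
have := IH (ltnW pl); rewrite /=; case: (odd p) => /=; lia.
Qed.

(** Let [d] be the exponents of [m] minus those of [m']. As [d] alternates
    on each path, the lexicographic comparison is decided on the first edge of
    a path [i], where [d] is positive, while [d] vanishes on the paths before
    [i]. The values of [d] on the first edges sum to 0 by the degree at [y_1],
    so [d] is negative on the first edge of a path [j] after [i]. Then [d] is
    positive on the odd edges of [i] and on the even edges of [j]. *)
Lemma umon_divides_larger m m' :
  @vdeg (bgraph l) m' =1 @vdeg (bgraph l) m -> lex_lt (@edge_gt h l) m' m ->
  exists i j : 'I_h, i < j /\ (umon l i j <= m)%MM.
Proof.
move=> E /existsP[e /andP[lt_e /forallP above]].
have alt e' := vdeg_eq_alternating e' E.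
pose y k := m (enum_rank (front_edge k false)).
pose y' k := m' (enum_rank (front_edge k false)).
pose i := path_of e.
have lt_i : y' i < y i.
  have := alt e; cbv zeta; rewrite -/i -/(y i) -/(y' i).
  have [e1|e1] := leqP (pos_of e) 1.
    rewrite /y /y' (_ : front_edge i false = e) //; apply: bedge_eq => //.
    by apply/esym/eqP; rewrite eqn_leq e1.
  have /implyP := above (front_edge i false).
  rewrite /edge_gt [pos_of (front_edge _ _)]/= e1 andbT -/(y i) -/(y' i).
  by case: (odd (pos_of e)) => /(_ isT)/eqP; lia.
have before_i (k : 'I_h) : k < i -> y' k = y k.
  move=> ki; have /implyP := above (front_edge k false).
  rewrite /edge_gt [pos_of (front_edge _ _)]/= [path_of (front_edge _ _)]/= ki -/(y k) -/(y' k).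
  have [e1|e1] := leqP (pos_of e) 1.
    by rewrite (_ : pos_of e = 1) => [/(_ isT)/eqP //|]; apply/eqP; rewrite eqn_leq e1.
  by case: (odd (pos_of e)) => /(_ isT)/eqP.
have := E (inl false); rewrite !vdeg_y1 -/(y' _) -/(y _) => sumE.
have [/existsP[j /andP[ij lt_j]]|/existsPn no] :=
  boolP [exists j : 'I_h, (i < j) && (y j < y' j)].
  exists i, j; split=> //; apply/mnm_le_edges => e'.
  have := alt e'; cbv zeta; rewrite umonE -/(y _) -/(y' _).
  have ji : (i == j) = false by apply/eqP => H; rewrite H ltnn in ij.
  case: (eqVneq (path_of e') i) => [->|_].
    by rewrite ji; case: (odd _) => //=; lia.
  by case: (eqVneq (path_of e') j) => [->|//]; case: (odd _) => //=; lia.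
suff : \sum_k y' k < \sum_k y k by rewrite /y' /y sumE ltnn.
rewrite (bigD1 i) // [ltnRHS](bigD1 i) //= -addSn leq_add // leq_sum // => k ki.
case: (ltnP k i) => [/before_i->//|ik].
by have := no k; rewrite ltn_neqAle ik eq_sym -val_eqE in ki *; rewrite ki /= -leqNgt.
Qed.

Lemma umon_lex_lt i j : i < j -> lex_lt (@edge_gt h l) (umon l j i) (umon l i j).
Proof.
move=> ij; apply/existsP; exists (front_edge i false).
have ji : (i == j) = false by apply/eqP => H; rewrite H ltnn in ij.
rewrite !umonE /path_of /pos_of /= eqxx ji /=.
apply/forallP => -[k q]; apply/implyP; rewrite !umonE /edge_gt /path_of /pos_of /=.
case/or3P => [|/andP[_]|/andP[/eqP[q0] ki]]; first by rewrite andbF.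
  by rewrite ltnS ltn0.
have -> : (k == i) = false by apply/eqP => H; rewrite H ltnn in ki.
by have -> : (k == j) = false by apply/eqP => H; rewrite H in ki; lia.
Qed.

Lemma umon_is_lead (K : fieldType) i j : i < j ->
  exists2 f, @toric_ideal K (bgraph l) f
           & is_lead_monomial (lex_lt (@edge_gt h l)) f (umon l i j).
Proof.
move=> ij; have lt := umon_lex_lt ij.
exists ('X_[umon l i j] - 'X_[umon l j i])%R.
  apply: toric_binomial => v; rewrite !umon_half_path !vdegD.
  by have := vdeg_half_path v (l_gt0 i); have := vdeg_half_path v (l_gt0 j); lia.
have ne : umon l j i != umon l i j.
  apply: contraTneq lt => ->; apply/existsP => -[e]; by rewrite ltnn.
split=> [|m].
  by rewrite mcoeff_msupp mcoeffB !mcoeffX eqxx (negPf ne) subr0 oner_neq0.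
by move=> /msuppD_le; rewrite mem_cat (perm_mem (msuppN _)) !msuppX !inE => /orP[->|/eqP->].
Qed.

Lemma half_path_le i o m :
  reflect (forall e, path_of e = i -> odd (pos_of e) = o -> 0 < m (enum_rank e))
          (half_path i o <= m)%MM.
Proof.
apply: (iffP (mnm_le_edges _ _)) => [le e ei eo|le e].
  by have := le e; rewrite half_pathE ei eo !eqxx.
by rewrite half_pathE; case: eqP => // ei; case: eqP => // eo; apply: le.
Qed.

Lemma half_path_neq0 i o : half_path i o != 0%MM.
Proof.
apply/eqP/mnmP => /(_ (enum_rank (front_edge i (~~ o)))).
by rewrite half_pathE mnm0E /path_of /pos_of /= eqxx; case: o.
Qed.

Lemma half_path_coprime i j o o' : i != j ->
  coprime_monomials (half_path i o) (half_path j o').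
Proof.
move=> ij; apply/forallP => k; rewrite -[k]enum_valK !half_pathE.
by case: (eqVneq (path_of _) i) => [->|//]; rewrite (negPf ij) orbT.
Qed.

Lemma umon_le_eq i j a b : (umon l i j <= umon l a b)%MM -> i = a /\ j = b.
Proof.
move=> /mnm_le_edges le; split; apply/eqP.
  by have := le (front_edge i false); rewrite !umonE /path_of /= eqxx !andbF andbT; case: eqP.
by have := le (front_edge j true); rewrite !umonE /path_of /= eqxx !andbF andbT; case: eqP.
Qed.

End HalfPaths.

(** * The list of generators *)

(** The listing of the generators is studied on index pairs, where it is the
    decreasing lexicographic order: [p] is listed before [q]. *)
Definition pair_before h (p q : 'I_h * 'I_h) : bool :=
  (q.1 < p.1) || (p.1 == q.1) && (q.2 < p.2).

Definition path_pairs h : seq ('I_h * 'I_h) :=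
  [seq (i, j) | i : 'I_h <- rev (enum 'I_h),
                j : 'I_h <- rev [seq j : 'I_h <- enum 'I_h | i < j]].

Lemma umonsE h (l : 'I_h -> nat) :
  umons l = [seq umon l p.1 p.2 | p <- path_pairs h].
Proof. by rewrite /path_pairs map_allpairs. Qed.

Lemma mem_path_pairs h (p : 'I_h * 'I_h) : (p \in path_pairs h) = (p.1 < p.2).
Proof.
case: p => i j; apply/allpairsPdep/idP => [[i' [j' [_ + [-> ->]]]]|ij].
  by rewrite mem_rev mem_filter => /andP[].
exists i, j; split=> //; rewrite mem_rev ?mem_enum //.
by rewrite mem_filter mem_enum andbT.
Qed.

Lemma path_pairs_sorted h : pairwise (@pair_before h) (path_pairs h).
Proof.
have dec (P : pred 'I_h) :
    pairwise (fun a b : 'I_h => b < a) (rev [seq j <- enum 'I_h | P j]).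
  rewrite -sorted_pairwise => [|b a c ba cb]; last exact: ltn_trans cb ba.
  rewrite rev_sorted sorted_pairwise => [|b a c]; last exact: ltn_trans.
  apply: pairwise_filter; rewrite -(pairwise_map (@nat_of_ord h) ltn).
  by rewrite val_enum_ord -(sorted_pairwise ltn_trans) iota_ltn_sorted.
rewrite /path_pairs; have := dec predT; rewrite filter_predT.
elim: (rev _) => //= a s IH /andP[/allP as_ /IH {}IH].
rewrite pairwise_cat IH andbT; apply/andP; split.
  apply/allrelP => _ _ /mapP[j _ ->] /allpairsPdep[i [k [/as_ ia _ ->]]].
  by rewrite /pair_before ia.
rewrite pairwise_map; apply: sub_pairwise (dec _) => j k kj.
by rewrite /pair_before /= eqxx kj orbT.
Qed.

Lemma mem_take_pairwise (T : eqType) (r : rel T) (s : seq T) x0 k x :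
  (forall y z, r y z -> ~~ r z y) -> pairwise r s -> k < size s ->
  (x \in take k s) = (x \in s) && r x (nth x0 s k).
Proof.
move=> asym rs ks; apply/idP/andP => [xs|[]].
  split; first exact: mem_take xs.
  move: rs; rewrite -{1}(cat_take_drop k s) (drop_nth x0 ks) pairwise_cat.
  by case/andP => /allrelP + _; apply => //; rewrite mem_head.
move: rs; rewrite -{1 2}(cat_take_drop k s) (drop_nth x0 ks) pairwise_cat.
case/and3P => _ _ /= /andP[/allP after _].
rewrite mem_cat inE => /or3P[//|/eqP->|/after/asym/negPf->//] xx.
by have := asym _ _ xx; rewrite xx.
Qed.

Lemma mem_take_path_pairs h k (p0 p : 'I_h * 'I_h) : k < size (path_pairs h) ->
  (p \in take k (path_pairs h)) = (p.1 < p.2) && pair_before p (nth p0 (path_pairs h) k).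
Proof.
move=> kh; rewrite (mem_take_pairwise p0 _ _ (path_pairs_sorted h)) ?mem_path_pairs //.
move=> [i j] [i' j']; rewrite /pair_before /= -!val_eqE /=; lia.
Qed.

Lemma size_later_paths h (i : 'I_h) :
  size [seq j : 'I_h <- enum 'I_h | i < j] = h.-1 - i.
Proof.
rewrite size_filter -(count_map (@nat_of_ord h) (fun j => i < j)) val_enum_ord.
have ih := ltn_ord i; rewrite -[in iota _ _](subnKC ih) iotaD count_cat.
rewrite (eq_in_count (a2 := pred0)) ?count_pred0 => [|j]; last first.
  by rewrite mem_iota /=; lia.
rewrite (eq_in_count (a2 := predT)) ?count_predT ?size_iota => [|j]; last first.
  by rewrite mem_iota /=; lia.
by lia.
Qed.

(** The prepended 0 stands for the first generator, which has no predecessor.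
    The first index [i] occurs in [h - 1 - i] pairs, so the value
    [d = h - 2 - i] is repeated [d + 1] times. *)
Lemma colon_lengths_path_pairs h : 2 <= h ->
  0 :: colon_lengths h = [seq h - 2 - p.1 | p : 'I_h * 'I_h <- path_pairs h].
Proof.
move=> h2; rewrite /path_pairs map_allpairs /=.
transitivity (flatten [seq nseq i i.-1 | i <- iota 0 h]).
  case: h h2 => [|[|h]] // _; rewrite /colon_lengths !subSS subn0 /=; congr cons.
  by rewrite (iotaDl 1 1) -map_comp.
congr flatten.
transitivity [seq nseq (h.-1 - i) (h - 2 - i) | i <- rev (iota 0 h)].
  apply: (@eq_from_nth _ [::]) => [|i]; first by rewrite !size_map size_rev.
  rewrite size_map size_iota => ih.
  rewrite !(nth_map 0) ?size_rev ?size_iota // nth_rev ?size_iota // !nth_iota //.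
    by congr nseq; lia.
  by lia.
rewrite -val_enum_ord -map_rev -map_comp; apply: eq_map => i /=.
by rewrite -size_later_paths -size_rev; elim: (rev _) => //= j s ->.
Qed.

(** * The colon ideals *)

Section Colons.
Variables (h : nat) (l : 'I_h -> nat) (l_gt0 : forall i, 0 < l i).
Implicit Types a b c : 'I_h.

Definition other_paths a b : seq 'I_h :=
  [seq c : 'I_h <- enum 'I_h | (a < c) && (c != b)].

Lemma size_other_paths a b : a < b -> size (other_paths a b) = h - 2 - a.
Proof.
move=> ab; rewrite /other_paths.
rewrite (eq_filter (a2 := predI (predC1 b) (fun c => a < c))); last first.
  by move=> c /=; rewrite andbC.
rewrite filter_predI -rem_filter; last by rewrite filter_uniq ?enum_uniq.
rewrite size_rem; last by rewrite mem_filter ab mem_enum.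
by rewrite size_later_paths; lia.
Qed.

Definition colon_generators a b : seq 'X_{1..#|bedge l|} :=
  [seq half_path l c (c < b) | c <- other_paths a b].

Lemma regular_colon_generators (K : fieldType) a b :
  regular_sequence [seq ('X_[m] : {mpoly K[#|bedge l|]}) | m <- colon_generators a b].
Proof.
apply: regular_sequence_coprime.
  rewrite pairwise_map; have := enum_uniq 'I_h.
  move=> /(filter_uniq (fun c => (a < c) && (c != b))); rewrite uniq_pairwise.
  by apply: sub_pairwise => c c' /= cc'; apply: half_path_coprime.
by apply/mapP => -[c _ /esym/eqP]; apply/negP; apply: half_path_neq0.
Qed.

(** [u_{i,j}] with [i > a], or [i = a] and [j > b], has a half path disjoint
    from [u_{a,b}]: the even half of [j] if [j > b], and otherwise the odd half
    of [i], where [a < i < b]. Conversely each of these halves [c] is completed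
    to an earlier generator by one half of [u_{a,b}]: [u_{a,c}] if [c > b] and
    [u_{c,b}] if [c < b]. *)
Lemma colon_divisibility (s : seq ('I_h * 'I_h)) a b m : a < b ->
  (forall p, (p \in s) = (p.1 < p.2) && pair_before p (a, b)) ->
  divided_by_some [seq umon l p.1 p.2 | p <- s] (umon l a b + m)%MM
    = divided_by_some (colon_generators a b) m.
Proof.
move=> ab sP.
have mem_other c : (c \in other_paths a b) = (a < c) && (c != b).
  by rewrite mem_filter mem_enum andbT.
apply/hasP/hasP => [[_ /mapP[[i j] + ->]]|[_ /mapP[c + ->]]].
  rewrite sP /pair_before /= => /andP[ij before] /mnm_le_edges le.
  (* the half of path [c] divides [u_{i,j}] and avoids both paths [a], [b] *)
  have [c [ac cb le_c]] : exists c, [/\ a < c, c != b &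
      (half_path l c (c < b)%N <= umon l i j)%MM].
    have [bj|jb] := ltnP b j.
      exists j; split; [lia|by rewrite -val_eqE /=; lia|].
      by rewrite ltnNge (ltnW bj) umon_half_path lem_addl.
    exists i; have [ai ib] : a < i /\ i < b.
      by move: before; rewrite -val_eqE /=; lia.
    by rewrite ib umon_half_path lem_addr -val_eqE /=; split=> //; lia.
  exists (half_path l c (c < b)).
    by apply/mapP; exists c; rewrite // mem_other ac.
  apply/half_path_le => e ec eo.
  have := le e; rewrite [leqRHS]mnmDE [X in _ <= X + _]umonE ec (negPf cb) andFb.
  have -> : (c == a) = false by rewrite -val_eqE /=; lia.
  by apply: leq_trans; move/mnm_le_edges: le_c => /(_ e); rewrite half_pathE ec eo !eqxx.
rewrite mem_other => /andP[ac cb] le_m.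
have [cb'|bc] := ltnP c b.
  exists (umon l c b).
    by apply/mapP; exists (c, b); rewrite // sP /pair_before /= ac cb'.
  rewrite cb' in le_m; rewrite !umon_half_path; apply/mnm_lepP => k.
  by move/mnm_lepP/(_ k): le_m; rewrite !mnmDE; lia.
have {cb} bc' : b < c by rewrite ltn_neqAle bc eq_sym val_eqE cb.
exists (umon l a c).
  by apply/mapP; exists (a, c); rewrite // sP /pair_before /= ac eqxx bc' orbT.
rewrite ltnNge bc /= in le_m; rewrite !umon_half_path; apply/mnm_lepP => k.
move/mnm_lepP/(_ k): le_m => le_m; rewrite !mnmDE -addnA leq_add2l.
exact: leq_trans le_m (leq_addl _ _).
Qed.

Lemma minimal_generators_umons (K : fieldType) :
  minimal_generators
    (initial_ideal (lex_lt (@edge_gt h l)) (@toric_ideal K (bgraph l))) (umons l).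
Proof.
apply: minimal_generators_mono.
- rewrite umonsE; apply: initial_ideal_mono => [_ /mapP[p + ->]|f m fI [mf lead]].
    by rewrite mem_path_pairs => /(umon_is_lead l_gt0 K).
  have [m' [m'f m'm E]] := toric_ideal_fibre fI mf.
  have [i [j [ij le]]] := umon_divides_larger l_gt0 E (lead _ m'f m'm).
  apply/hasP; exists (umon l i j) => //.
  by apply/mapP; exists (i, j); rewrite ?mem_path_pairs.
- apply: pairwise_uniq (umons_increasing l_gt0) => m.
  by apply/existsP => -[e]; rewrite ltnn.
move=> _ _ /allpairsPdep[i [j [_ _ ->]]] /allpairsPdep[a [b [_ _ ->]]].
by move=> /(umon_le_eq l_gt0) [-> ->].
Qed.

Lemma colon_before_umons (K : fieldType) k : 2 <= h -> 2 <= k <= size (umons l) ->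
  exists s : seq {mpoly K[#|bedge l|]},
    [/\ size s = nth 0 (colon_lengths h) (k - 2), regular_sequence s
      & same_ideal (colon_before (umons l) k) (seq_ideal s)].
Proof.
move=> h2; rewrite umonsE size_map => /andP[k2 kh].
have k_lt : k.-1 < size (path_pairs h) by lia.
have p0 : 'I_h * 'I_h by case: (path_pairs h) k_lt.
case E: (nth p0 (path_pairs h) k.-1) => [a b].
have ab : a < b by have := mem_nth p0 k_lt; rewrite E mem_path_pairs.
exists [seq 'X_[m] | m <- colon_generators a b]; split.
- rewrite !size_map size_other_paths //.
  have -> : nth 0 (colon_lengths h) (k - 2) = nth 0 (0 :: colon_lengths h) k.-1.
    by case: k k2 {kh k_lt E} => [|[|k]] //; rewrite !subSS subn0.
  by rewrite colon_lengths_path_pairs // (nth_map p0) // E.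
- exact: regular_colon_generators.
move=> p; rewrite /colon_before -map_take (nth_map p0) // E.
rewrite colon_mono_idealP -/(mono_ideal _ p) mono_idealP.
have div m := @colon_divisibility (take k.-1 (path_pairs h)) a b m ab.
have sP q := mem_take_path_pairs p0 q k_lt; rewrite E in sP.
by split=> H m /H; rewrite div.
Qed.

End Colons.

Theorem proposition4p3 (K : fieldType) (h : nat) (l : 'I_h -> nat)
    (h_ge2 : 2 <= h) (l_gt0 : forall j : 'I_h, 0 < l j) :
  regular_quotients
    (initial_ideal (lex_lt (@edge_gt h l)) (@toric_ideal K (bgraph l)))
    (umons l)
  /\ forall k : nat, 2 <= k <= (h * h.-1)./2 ->
     exists s : seq {mpoly K[#|bedge l|]},
       [/\ size s = nth 0 (colon_lengths h) (k - 2),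
           regular_sequence s
         & same_ideal (colon_before (umons l) k) (seq_ideal s)].
Proof.
rewrite -(size_umons l); split; last by move=> k; apply: colon_before_umons.
split=> [|k /(colon_before_umons l_gt0 K h_ge2)[s [_ reg eq_s]]].
  exact: minimal_generators_umons.
by exists s.
Qed.
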